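(* Let ${\cal M}$ be an orientably regular map on a compact oriented surface. Then $\mathrm{Aut}^+{\cal M}$ acts primitively and faithfully on the vertices of ${\cal M}$ if and only if ${\cal M}$ is isomorphic to a generalised Paley map ${\cal M}_q(s)$ for some admissible pair $q,n$ and some generator $s$ of the subgroup of order $n$ of $F_q^*$.
   Context: A map is orientably regular if its group $\mathrm{Aut}^+{\cal M}$ of orientation-preserving automorphisms acts transitively on its arcs. An admissible pair consists of $q=p^e$ ($p$ prime) and a positive divisor $n$ of $q-1$ such that $n$ is even if $p>2$ and $e$ is the multiplicative order of $p$ modulo $n$. For such a pair let $S$ be the subgroup of order $n$ of $F_q^*$ (it contains $-1$); the generalised Paley graph $P_q^{(n)}$ has vertex set $F_q$ with $v,w$ adjacent iff $v-w\in S$, and for a generator $s$ of $S$ the generalised Paley map ${\cal M}_q(s)$ embeds $P_q^{(n)}$ in an oriented surface so that the rotation of neighbours of each vertex $v$ is $v+1,v+s,\dots,v+s^{n-1}$. *)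

(* Defs.v *)
From HB Require Import structures.
From mathcomp Require Import all_boot all_order all_algebra.
From mathcomp Require Import all_fingroup all_solvable all_field.
Set Implicit Arguments.
Unset Strict Implicit.
Unset Printing Implicit Defensive.
Import GRing.Theory.
Local Open Scope group_scope.

(* A map on a compact connected oriented surface, given by its finite set of
   arcs (directed edges): [arc_rot] sends each arc to the next one around its
   initial vertex, following the orientation, and [arc_rev] reverses each arc.
   Loops and multiple edges are allowed, free edges are not. Transitivity of
   the group generated by [arc_rot] and [arc_rev] expresses connectedness; the
   faces are the cycles of [arc_rev * arc_rot]. *)
Record oriented_map := OrientedMap {
  map_arc :> finType;
  arc_rot : {perm map_arc};
  arc_rev : {perm map_arc};
  arc_rev_involutive : involutive arc_rev;
  arc_rev_fixfree : forall x : map_arc, arc_rev x != x;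
  map_connected :
    [transitive <<[set arc_rot; arc_rev]>>, on [set: map_arc] | 'P]
}.

Arguments arc_rot {o}.
Arguments arc_rev {o}.

(* A vertex is identified with the set of arcs leaving it. *)
Definition vertices (M : oriented_map) : {set {set M}} := porbits (@arc_rot M).

(* Orientation-preserving isomorphism. *)
Definition map_isomorphic (M N : oriented_map) : Prop :=
  exists f : M -> N,
    [/\ bijective f,
        {morph f : x / arc_rot x >-> arc_rot x} &
        {morph f : x / arc_rev x >-> arc_rev x}].

Definition map_aut_set (M : oriented_map) : {set {perm M}} :=
  [set g : {perm M} | [forall x, g (arc_rot x) == arc_rot (g x)] &&
                      [forall x, g (arc_rev x) == arc_rev (g x)]].

Lemma map_aut_group_set (M : oriented_map) : group_set (map_aut_set M).
Proof.
apply/group_setP; split=> [|g h].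
  by rewrite inE; apply/andP; split; apply/forallP=> x; rewrite !perm1.
rewrite !inE => /andP[/forallP gR /forallP gL] /andP[/forallP hR /forallP hL].
apply/andP; split; apply/forallP=> x; rewrite !permM.
  by rewrite (eqP (gR x)) (eqP (hR _)).
by rewrite (eqP (gL x)) (eqP (hL _)).
Qed.

(* Aut^+ M. Permuting arcs, it acts on vertices through the induced action 'P^*
   on sets of arcs. *)
Definition map_aut (M : oriented_map) : {group {perm M}} :=
  Group (map_aut_group_set M).

Definition orientably_regular (M : oriented_map) : bool :=
  [transitive map_aut M, on [set: M] | 'P].

(* [e] is the multiplicative order of [p] modulo [n]; it is 1 if n = 1. *)
Definition is_mult_order (n p e : nat) : Prop :=
  [/\ 0 < e, p ^ e = 1 %[mod n] &
      forall k, 0 < k -> p ^ k = 1 %[mod n] -> e <= k]%N.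

Definition admissible (q n : nat) : Prop :=
  exists p e : nat,
    [/\ prime p, q = p ^ e, (0 < n) && (n %| q.-1),
        (2 < p -> ~~ odd n) & is_mult_order n p e]%N.

Local Open Scope ring_scope.

Definition paley_adj (F : finFieldType) (S : {set {unit F}}) (v w : F) : bool :=
  v - w \in [set FinRing.uval u | u in S].

Definition paley_arc (F : finFieldType) (S : {set {unit F}}) : finType :=
  {vw : F * F | paley_adj S vw.1 vw.2}.

Lemma mem_paley_connE (F : finFieldType) (S : {group {unit F}}) (x : F) :
  (x \in [set FinRing.uval u | u in S]) = (x ^+ #|S| == 1).
Proof.
pose A := [set FinRing.uval u | u in S]; pose B := [set y : F | y ^+ #|S| == 1].
suff eAB: A = B by rewrite -/A eAB inE.
apply/eqP; rewrite eqEcard; apply/andP; split.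
  apply/subsetP=> _ /imsetP[u Su ->]; rewrite inE.
  by rewrite -[FinRing.uval u]/(val u) -FinRing.val_unitX expg_cardG.
rewrite card_imset; last exact: val_inj.
rewrite cardE; apply: max_unity_roots; first exact: cardG_gt0.
  by apply/allP=> y; rewrite mem_enum inE unity_rootE.
exact: enum_uniq.
Qed.

Section PaleyMap.

Context (q n : nat) (adm : admissible q n) (F : finFieldType) (cardF : #|F| = q).
Context (S : {group {unit F}}) (cardS : #|S| = n).
Context (s : {unit F}) (genS : generator S s).

Lemma paley_adj_sym (v w : F) : paley_adj S v w -> paley_adj S w v.
Proof.
rewrite /paley_adj !mem_paley_connE -(opprB v w) => /eqP vw1.
rewrite exprNn vw1 mulr1 -signr_odd.
case: adm => p [e [pr_p def_q _ odd_n _]].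
have [p_gt2 | p_le2] := ltnP 2 p.
  by rewrite cardS (negPf (odd_n p_gt2)).
have p2 : p = 2%N by apply/eqP; rewrite eqn_leq p_le2 prime_gt1.
have ch2 : 2%N \in [pchar F].
  by apply: (@card_finPcharP F 2 e) => //; rewrite cardF def_q p2.
by rewrite oppr_pchar2 // expr1n.
Qed.

Lemma paley_adj_rot (v w : F) :
  paley_adj S v w -> paley_adj S v (v + val s * (w - v)).
Proof.
have Ss : s \in S by rewrite (eqP genS) cycle_id.
rewrite /paley_adj => /imsetP[u Su vw].
rewrite opprD addNKr -mulrN opprB vw; apply/imsetP.
by exists (s * u)%g; rewrite ?groupM.
Qed.

Definition paley_rot_fun (x : paley_arc S) : paley_arc S :=
  exist _ ((val x).1, (val x).1 + val s * ((val x).2 - (val x).1))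
          (paley_adj_rot (valP x)).

Definition paley_rev_fun (x : paley_arc S) : paley_arc S :=
  exist _ ((val x).2, (val x).1) (paley_adj_sym (valP x)).

Lemma paley_rot_inj : injective paley_rot_fun.
Proof.
move=> [[v w] xP] [[v' w'] yP] /(congr1 val)[/= evv].
case: v' / evv yP => yP /addrI/(mulrI (valP s))/addIr=> eww.
by apply: val_inj; rewrite /= eww.
Qed.

Lemma paley_revK : involutive paley_rev_fun.
Proof. by move=> x; apply: val_inj => /=; case: (val x). Qed.

(* The arc (v, v + s^i) goes to (v, v + s^(i+1)). *)
Definition paley_rot : {perm paley_arc S} := perm paley_rot_inj.
Definition paley_rev : {perm paley_arc S} := perm (inv_inj paley_revK).

Lemma paley_rev_involutive : involutive paley_rev.
Proof. by move=> x; rewrite !permE paley_revK. Qed.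

Lemma paley_rev_fixfree (x : paley_arc S) : paley_rev x != x.
Proof.
case: x => [[v w] vw]; rewrite permE; apply/negP=> /eqP/(congr1 val)[wv _].
move: (vw); rewrite /paley_adj /= wv subrr mem_paley_connE expr0n.
by rewrite eqn0Ngt cardG_gt0 eq_sym oner_eq0.
Qed.

(* By minimality of e, S spans F additively. *)
Lemma paley_span (W : {group F}) :
  [set FinRing.uval u | u in S] \subset W ->
  (forall x y, x \in W -> y \in W -> x * y \in W) -> W = [set: F] :> {set F}.
Proof.
move=> sSW WM; case: adm => p [e [pr_p def_q _ _ [e_gt0 _ min_e]]].
have S1 : FinRing.uval (1%g : {unit F}) = 1 by [].
have W1 : 1 \in W by rewrite (subsetP sSW) // -S1 imset_f.
have gU : group_set [set u : {unit F} | val u \in W].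
  by apply/group_setP; split=> [|u v]; rewrite !inE // => Wu Wv; apply: WM.
pose U := Group gU.
have cardU : #|W| = #|U|.+1.
  rewrite (cardsD1 0) group1 add1n; congr _.+1.
  rewrite -(card_imset _ (@val_inj _ _ {unit F})); apply: eq_card => x.
  apply/idP/imsetP=> [|[u]]; rewrite !inE.
    rewrite -unitfE => /andP[ux Wx].
    by exists (FinRing.Unit ux); rewrite ?inE.
  by move=> Wu ->; rewrite Wu -unitfE (valP u).
have n_U : (n %| #|U|)%N.
  rewrite -cardS cardSg //; apply/subsetP=> u Su.
  by rewrite inE (subsetP sSW) // imset_f.
have pW : p.-group W.
  rewrite /pgroup (pnat_dvd (cardSg (subsetT W))) // cardsT cardF def_q.
  by rewrite pnatX pnat_id.
have [k cardW] := p_natP pW.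
have W_gt1 : (1 < #|W|)%N by rewrite cardU ltnS cardG_gt0.
have k_gt0 : (0 < k)%N by case: k cardW W_gt1 => // ->.
have le_ek : (e <= k)%N.
  apply: min_e => //; rewrite -cardW cardU -add1n -modnDmr.
  by rewrite (eqP n_U) addn0.
apply/eqP; rewrite eqEcard subsetT cardsT cardF def_q cardW.
by rewrite leq_exp2l // prime_gt1.
Qed.

Lemma paley_connected :
  [transitive <<[set paley_rot; paley_rev]>>, on [set: paley_arc S] | 'P].
Proof.
pose G := <<[set paley_rot; paley_rev]>>%G.
have GR : paley_rot \in G by rewrite mem_gen // !inE eqxx.
have GL : paley_rev \in G by rewrite mem_gen // !inE eqxx orbT.
have adj v (u : {unit F}) : u \in S -> paley_adj S v (v + val u).
  move=> Su; apply: paley_adj_sym; rewrite /paley_adj addrAC subrr add0r.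
  exact: imset_f.
have x0P : paley_adj S 0 1.
  by rewrite -[1]add0r; apply: (adj 0 1%g); apply: group1.
pose x0 : paley_arc S := exist _ (0, 1) x0P.
pose O := orbit 'P G x0.
have OG g x : g \in G -> (g x \in O) = (x \in O).
  by move=> Gg; rewrite -[g x]/('P%act x g) /O orbit_actr.
have star (x y : paley_arc S) : (val x).1 = (val y).1 -> x \in O -> y \in O.
  move=> exy Ox.
  have [a Sa ea] := imsetP (valP x); have [b Sb eb] := imsetP (valP y).
  have : (a^-1 * b)%g \in <[s]>%g by rewrite -(eqP genS) groupM ?groupV.
  case/cycleP=> i ei.
  suff -> : y = (paley_rot ^+ i)%g x by rewrite OG ?groupX.
  have rotX : val ((paley_rot ^+ i)%g x) =
      ((val x).1, (val x).1 + val s ^+ i * ((val x).2 - (val x).1)).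
    elim: i {ei} => [|i IH].
      by rewrite expg0 perm1 expr0 mul1r addrC subrK; case: (val x).
    rewrite expgSr permM permE /= IH /=; congr (_, _).
    by rewrite [X in _ * X]addrAC subrr add0r mulrA -exprS.
  apply: val_inj; rewrite rotX -FinRing.val_unitX -ei {rotX Ox}.
  case: x y exy ea eb => [[v w] xP] [[v' w'] yP] /= {xP yP} <- ea eb.
  congr (_, _); rewrite -opprB ea mulrN mulrAC mulVr ?mul1r ?(valP a) // -eb.
  by rewrite opprB addrC subrK.
pose V := [set v | [forall x : paley_arc S, ((val x).1 == v) ==> (x \in O)]].
have VP v : reflect (forall x : paley_arc S, (val x).1 = v -> x \in O) (v \in V).
  rewrite inE; apply: (iffP forallP) => H x; first by move/eqP; apply/implyP.
  by apply/implyP=> /eqP; apply: H.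
have V0 : 0 \in V by apply/VP=> x ex; apply: (star x0) => //; apply: orbit_refl.
have VD v (u : {unit F}) : v \in V -> u \in S -> v + val u \in V.
  move=> /VP Vv Su; apply/VP=> x ex.
  pose y : paley_arc S := exist _ (v, v + val u) (adj v u Su).
  apply: (star (paley_rev y)); first by rewrite permE ex.
  by rewrite OG //; apply: Vv.
have gW : group_set [set t | [forall v in V, v + t \in V]].
  apply/group_setP; split=> [|a b].
    by rewrite inE; apply/forall_inP=> v; rewrite addr0.
  rewrite !inE => /forall_inP Va /forall_inP Vb; apply/forall_inP=> v Vv.
  by rewrite addrA; apply/Vb/Va.
pose A := [set FinRing.uval u | u in S]; pose W := <<A>>%G.
have sWV : W \subset V.
  have : W \subset Group gW.
    rewrite gen_subG; apply/subsetP=> _ /imsetP[u Su ->]; rewrite inE.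
    by apply/forall_inP=> v Vv; apply: VD.
  move/subsetP=> sW; apply/subsetP=> t /sW; rewrite inE.
  by move/forall_inP/(_ 0 V0); rewrite add0r.
have AM a b : a \in A -> b \in A -> a * b \in A.
  by rewrite !mem_paley_connE exprMn => /eqP-> /eqP->; rewrite mulr1.
have gmul (X : {set F}) (a : F) :
    (forall b, b \in X -> a * b \in W) -> forall b, b \in <<X>>%g -> a * b \in W.
  move=> aX b; have gX : group_set [set c | a * c \in W].
    apply/group_setP; split=> [|c d]; first by rewrite inE mulr0 group1.
    by rewrite !inE mulrDr => Wc Wd; apply: groupM.
  have : <<X>>%G \subset Group gX.
    by rewrite gen_subG; apply/subsetP=> c Xc; rewrite inE aX.
  by move/subsetP=> H /H; rewrite inE.
have WM a b : a \in W -> b \in W -> a * b \in W.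
  move=> Wa; apply: (gmul) => c Ac; rewrite mulrC; move: a Wa; apply: (gmul) => a Aa.
  by rewrite mem_gen // AM.
have WT := paley_span (subset_gen A) WM.
apply/imsetP; exists x0; rewrite ?inE //; apply/setP=> x; rewrite inE.
apply/esym; have /VP : (val x).1 \in V by rewrite (subsetP sWV) ?WT ?inE.
exact.
Qed.

Definition paley_map : oriented_map :=
  OrientedMap paley_rev_involutive paley_rev_fixfree paley_connected.

End PaleyMap.

(* Main.v *)
Require Import Defs.
From mathcomp Require Import all_boot all_order all_algebra.
From mathcomp Require Import all_fingroup all_solvable all_field all_character.
(* Undoes the shadowing of [Defs.arc_rot] by [path.arc_rot]. *)
Import Defs.
Set Implicit Arguments.
Unset Strict Implicit.
Unset Printing Implicit Defensive.
Import GRing.Theory MatrixGenField.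
Local Open Scope group_scope.

(** The automorphism group [G] of a regular map is regular on arcs, so the
stabiliser [H] of a vertex is cyclic, generated by the rotation [h] at that
vertex. If [G] is primitive and faithful on vertices, [H] is a core-free maximal
subgroup; being abelian, it meets its other conjugates trivially, so [G] is a
Frobenius group (or has prime order) and [G = K ><| H]. Irreducibility of [H] on
[K] makes [K] elementary abelian, and by Schur's lemma it is a one-dimensional
space over the field [F] generated by [h], which acts as multiplication by some
[s]. Identifying the vertices with [K], hence with [F], so that the neighbour of
[0] along the base arc is [1], turns the map into the generalised Paley map of
[s]. Conversely, [G] contains the maps [v |-> u v + b] with [u \in S], so the
orbit of [0] under a group between [H] and [G] is an additive subgroup stable
under the subring spanned by [S], which is [F]. *)

(** * Finite groups with a core-free abelian maximal subgroup *)

Section MaximalCorefreeAbelian.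

Variables (gT : finGroupType) (G H : {group gT}).
Hypotheses (maxH : maximal H G) (cHH : abelian H).
Hypothesis corefreeH : forall N : {group gT}, N <| G -> N \subset H -> N :=: 1.

Let sHG : H \subset G. Proof. by have /maxgroupp/proper_sub := maxH. Qed.

(* A nontrivial element of [H :&: H :^ g] is centralised by [<<H, H :^ g>> = G]
   when [g \notin H], hence generates a normal subgroup inside [H]. *)
Lemma corefree_maximal_abelian_Frobenius : H :!=: 1 -> [Frobenius G with complement H].
Proof.
move=> ntH; have [ltHG maxHG] := maxgroupP maxH.
have ovH (L : {group gT}) : H \subset L -> L \subset G -> L :=: H \/ L :=: G.
  move=> sHL; rewrite subEproper => /predU1P[|pL]; [by right | left].
  exact: maxHG.
apply/andP; split; first by rewrite (proper_neq ltHG).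
apply/normedTI_memJ_P; split=> // [|a g /setD1P[nta Ha] Gg].
  by rewrite setD_eq0 subG1.
rewrite !inE conjg_eq1 nta /=; apply/idP/idP=> [Hag | Hg]; last by rewrite groupJ.
apply: contraR nta => notHg.
have cG : G \subset 'C[a].
  have sHC : H \subset 'C_G[a].
    by rewrite subsetI sHG sub_cent1 (subsetP cHH).
  have [defC | <-] := ovH _ sHC (subsetIl _ _); last exact: subsetIr.
  (* As [a ^ g] lies in the abelian group [H], it is centralised by [H], so [H :^ g^-1] centralises
     [a]. If ['C_G[a]] were only [H], then [g] would normalise [H], and maximality would make [H]
     normal in [G], against core-freeness. *)
  have CHg : H :^ g^-1 \subset H.
    rewrite -{2}defC subsetI; apply/andP; split.
      by rewrite -(conjGid (groupVr Gg)) conjSg.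
    by rewrite sub_conjgV -cent1J sub_cent1 (subsetP cHH).
  have nHg : g \in 'N(H) by rewrite -groupV inE.
  have [|/setP/(_ g)|nH] := ovH 'N_G(H)%G _ (subsetIl _ _).
  - by rewrite subsetI sHG normG.
  - by rewrite inE Gg nHg (negPf notHg).
  by case/eqP: ntH; apply: corefreeH => //; rewrite /normal sHG -nH subsetIr.
have : <[a]>%G :=: 1.
  apply: corefreeH; last by rewrite cycle_subG.
  rewrite /normal cycle_subG (subsetP sHG) // cents_norm // centsC cycle_subG.
  by rewrite -sub_cent1.
by move/eqP; rewrite cycle_eq1.
Qed.

(** [K] is the Frobenius kernel. Frobenius complements are nontrivial, so [H = 1] is treated apart,
    with [K = G]. *)
Lemma corefree_maximal_abelian_split :
  exists2 K : {group gT}, K ><| H = G & coprime #|K| #|H|.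
Proof.
have [H1 | ntH] := eqVneq (gval H) 1.
  by exists G; rewrite H1 ?sdprodg1 // cards1 coprimen1.
have [K frobG] := Frobenius_kernel_exists (corefree_maximal_abelian_Frobenius ntH).
by exists K; [case/andP: frobG => /eqP | exact: Frobenius_coprime frobG].
Qed.

(** For an [H]-invariant [A] inside [K], the group [A <*> H] lies between [H] and [G]. If it is [G],
    comparing orders gives [A = K]; if it is [H], then [A] lies in the trivial group [K :&: H]. *)
Lemma maximal_sdprod_minnormal (K : {group gT}) : K ><| H = G -> minnormal K H.
Proof.
move=> defG; have [_ KH nKH tiKH] := sdprodP defG.
have [ltHG maxHG] := maxgroupP maxH.
apply/mingroupP; split=> [|A /andP[ntA nAH] sAK].
  rewrite nKH andbT; apply: contraTneq ltHG => K1.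
  by rewrite -KH K1 mul1g properxx.
have sAG : A \subset G by rewrite (subset_trans sAK) // -KH mulG_subl.
have [AHG|nAHG] := eqVneq (A <*> H) G.
  apply/eqP; rewrite eqEcard sAK -(leq_pmul2r (cardG_gt0 H)).
  by rewrite -TI_cardMg // KH -AHG norm_joinEr // mul_cardG leq_pmulr ?cardG_gt0.
have AHH : A <*> H = H.
  apply: (maxHG (A <*> H)%G); last exact: joing_subr.
  by rewrite properEneq nAHG join_subG sAG.
case/eqP: ntA; apply/trivgP; rewrite -tiKH subsetI sAK -AHH; exact: joing_subl.
Qed.

(* The prime-power order of [K] comes from an [H]-invariant Sylow subgroup, so
   that Thompson's theorem on Frobenius kernels is not needed. *)
Lemma corefree_maximal_abelian_affine :
  exists (p : nat) (K : {group gT}),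
    [/\ prime p, p.-abelem K, K ><| H = G, minnormal K H & 'C_H(K) = 1].
Proof.
have [K defG coKH] := corefree_maximal_abelian_split.
have minK := maximal_sdprod_minnormal defG.
have [/andP[ntK nKH] minKH] := mingroupP minK.
have [_ KH _ tiKH] := sdprodP defG.
set p := pdiv #|K|; have pr_p : prime p by rewrite pdiv_prime ?cardG_gt1.
have [P sylP nPH] := sol_coprime_Sylow_exists p (abelian_sol cHH) nKH coKH.
have PK : P :=: K.
  apply: minKH; rewrite ?(pHall_sub sylP) // nPH andbT.
  by rewrite -rank_gt0 (rank_Sylow sylP) p_rank_gt0 pi_pdiv cardG_gt1.
have pK : p.-group K by rewrite -PK (pHall_pgroup sylP).
exists p, K; split=> //.
  (* ['Phi(K)] is proper and characteristic in [K], hence [H]-invariant, so minimality makes it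
     trivial. *)
  rewrite -trivg_Phi //; apply: contraTT (Phi_proper ntK) => ntPhi.
  rewrite (minKH 'Phi(K)%G) ?properxx ?Phi_sub // ntPhi.
  exact: char_norm_trans (Phi_char K) nKH.
(* ['C_H(K)] is centralised by [K] and normalised by [H], so it is normal in [G = K * H]. *)
apply: (corefreeH (N := 'C_H(K)%G)); last exact: subsetIl.
rewrite /normal subIset ?sHG //= -KH mulG_subG.
rewrite cents_norm ?(centsC K) ?subsetIr //.
by rewrite normsI ?normG ?norms_cent.
Qed.
End MaximalCorefreeAbelian.

(** * Fields from irreducible cyclic actions *)

(* By Schur's lemma the matrix of [h] generates a field, and by irreducibility
   [K] is a one-dimensional space over it. *)
Lemma minnormal_abelem_field (gT : finGroupType) (p : nat) (K : {group gT})
    (h k0 : gT) :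
    p.-abelem K -> minnormal K <[h]> -> k0 \in K -> k0 != 1 ->
  exists (F : finFieldType) (s : {unit F}) (phi : F -> gT),
    [/\ injective phi, phi @: [set: F] = K,
        {morph phi : x y / (x + y)%R >-> x * y},
        phi 1%R = k0 & forall x, phi (val s * x)%R = phi x ^ h].
Proof.
move=> abelK minK Kk0 ntk0.
have [/andP[ntK nKh] minKh] := mingroupP minK.
pose rG := abelem_repr abelK ntK nKh.
have irrG : mx_irreducible rG by apply/abelem_mx_irrP.
have hh : h \in <[h]> := cycle_id h.
have cA : centgmx rG (rG h).
  apply/centgmxP=> g hg; rewrite -!repr_mxM //; congr (rG _).
  exact: (centsP (cycle_abelian h)).
pose F : finFieldType := gen_of irrG cA.
pose v := abelem_rV abelK ntK k0.
have nzv : (v != 0)%R.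
  apply: contraNneq ntk0 => v0.
  by rewrite -(abelem_rV_K abelK ntK Kk0) -/v v0 rVabelem0.
have nzs : ((groot irrG cA : F) != 0)%R.
  apply: contraTneq (repr_mx_unit rG hh) => s0.
  rewrite -(mxval_groot irrG cA) s0 mxval0.
  by rewrite unitmxE det0 unitr0.
have us : ((groot irrG cA : F) \is a GRing.unit)%R by rewrite unitfE.
(* A field element is a matrix commuting with [h]; [phi] evaluates it at the vector [v] of [k0].
   Nonzero elements are invertible and [v] is nonzero, so [phi] is injective. *)
pose phi (x : F) := rVabelem abelK ntK (v *m mxval x)%R.
have phiD : {morph phi : x y / (x + y)%R >-> x * y}.
  by move=> x y; rewrite /phi mxvalD mulmxDr rVabelemD.
have phih x : phi (groot irrG cA * x)%R = phi x ^ h.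
  by rewrite /phi mulrC mxvalM mxval_groot mulmxA rVabelemJ.
have phi1 : phi 1%R = k0 by rewrite /phi mxval1 mulmx1 abelem_rV_K.
have phi_inj : injective phi.
  move=> x y /rVabelem_inj/eqP; rewrite -subr_eq0 -mulmxBr -raddfB => /eqP vz.
  apply/eqP; rewrite -subr_eq0; apply: contraNT nzv => nz.
  apply/eqP; move/(congr1 (mulmx^~ (mxval (x - y)^-1)%R)): vz.
  by rewrite -mulmxA -mxvalM mulfV // mxval1 mulmx1 mul0mx.
exists F, (FinRing.Unit us), phi; split=> //.
(* The image is a nontrivial subgroup of [K] normalised by [h], so minimality makes it [K]. *)
have gP : group_set (phi @: [set: F]).
  apply/group_setP; split.
    by apply/imsetP; exists 0%R; rewrite // /phi mxval0 mulmx0 rVabelem0.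
  move=> _ _ /imsetP[x _ ->] /imsetP[y _ ->].
  by rewrite -phiD imset_f.
apply: (minKh (Group gP)); last first.
  by apply/subsetP=> _ /imsetP[x _ ->]; apply: mem_rVabelem.
apply/andP; split.
  by apply/trivgPn; exists k0 => //; apply/imsetP; exists 1%R.
rewrite cycle_subG inE; apply/subsetP=> _ /imsetP[_ /imsetP[x _ ->] ->] /=.
by rewrite -phih imset_f.
Qed.

(* If [p ^ k = 1 %[mod #[s]]], then the fixed field of [x |-> x ^+ (p ^ k)]
   contains [s], so it is all of [F]. *)
Lemma cyclic_span_admissible (F : finFieldType) (s : {unit F}) (p e : nat) :
    prime p -> #|F| = (p ^ e)%N -> (2 < p -> ~~ odd #[s])%N ->
    (forall W : {group F}, 1%R \in W ->
       (forall x, x \in W -> (val s * x)%R \in W) -> W = [set: F] :> {set F}) ->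
  admissible #|F| #[s].
Proof.
move=> pr_p cardF odd_s spanF.
have e_gt0 : (0 < e)%N.
  by rewrite lt0n; apply: contraTneq (finNzRing_gt1 F) => e0; rewrite cardF e0.
have s_dvd : #[s] %| #|F|.-1.
  by rewrite -card_finField_unit; apply: order_dvdG; rewrite inE.
have F_gt0 : (0 < #|F|)%N by rewrite ltnW ?finNzRing_gt1.
exists p, e; split; rewrite ?order_gt0 //; split=> // [|k k_gt0 pk1].
  by apply/eqP; rewrite -cardF eqn_mod_dvd // subn1.
have pk_gt1 : (1 < p ^ k)%N by rewrite -(exp1n k) ltn_exp2r ?prime_gt1.
have chF : p \in [pchar F]%R by apply: (@card_finPcharP F p e).
have pkF : ([pchar F]%R).-nat (p ^ k)%N by rewrite pnatX pnatE ?chF.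
have gW : group_set [set x : F | (x ^+ (p ^ k) == x)%R].
  apply/group_setP; split=> [|x y]; rewrite !inE.
    by rewrite expr0n gtn_eqF ?(ltnW pk_gt1).
  by move=> /eqP xE /eqP yE; rewrite exprDn_pchar // xE yE.
have WT := spanF (Group gW).
have{WT} FE (x : F) : (x ^+ (p ^ k) = x)%R.
  apply/eqP; have : x \in Group gW; last by rewrite inE.
  rewrite WT ?inE ?expr1n // => y; rewrite !inE exprMn => /eqP->.
  rewrite -FinRing.val_unitX -(prednK (ltnW pk_gt1)) expgSr.
  suff /eqP-> : s ^+ (p ^ k).-1 == 1 by rewrite mul1g.
  rewrite -order_dvdn -subn1 -eqn_mod_dvd ?(ltnW pk_gt1) //; exact/eqP.
(* All [#|F|.-1] nonzero elements are roots of [X ^ (p ^ k - 1) - 1], which bounds [p ^ e] by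
   [p ^ k]. *)
rewrite -(leq_exp2l _ _ (prime_gt1 pr_p)) -cardF.
rewrite -(prednK F_gt0) -(prednK (ltnW pk_gt1)) ltnS -(cardC1 (0%R : F)) cardE.
apply: max_unity_roots; rewrite ?enum_uniq //; first by rewrite -subn1 subn_gt0.
apply/allP=> x; rewrite mem_enum !inE unity_rootE => nzx.
rewrite -(inj_eq (mulfI nzx)) mulr1 -exprS prednK ?(ltnW pk_gt1) //.
by rewrite FE.
Qed.

(** * Automorphism groups and vertex stabilisers of maps *)

Section MapAut.

Variable M : oriented_map.
Implicit Types (x y : M) (g : {perm M}).

Definition vertex_of x := porbit (@arc_rot M) x.

Lemma map_autP g :
  reflect ({morph g : x / arc_rot x} /\ {morph g : x / arc_rev x})
          (g \in map_aut M).
Proof.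
rewrite inE; apply: (iffP andP) => [[/forallP gR /forallP gL] | [gR gL]].
  by split=> x; apply/eqP.
by split; apply/forallP=> x; apply/eqP.
Qed.

Lemma map_aut_rot g x : g \in map_aut M -> g (arc_rot x) = arc_rot (g x).
Proof. by case/map_autP=> gR _; apply: gR. Qed.

Lemma map_aut_rev g x : g \in map_aut M -> g (arc_rev x) = arc_rev (g x).
Proof. by case/map_autP=> _; apply. Qed.

Lemma map_aut_cent : map_aut M \subset 'C(<<[set @arc_rot M; @arc_rev M]>>).
Proof.
rewrite cent_gen; apply/subsetP=> g Gg; apply/centP=> d.
rewrite !inE => /orP[]/eqP->; apply/permP=> x; rewrite !permM.
  by rewrite map_aut_rot.
by rewrite map_aut_rev.
Qed.

(** Automorphisms commute with the transitive group generated by [arc_rot] and [arc_rev], so the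
    image of one arc determines all the others. *)
Lemma map_aut_inj x :
  {in map_aut M &, forall g g' : {perm M}, g x = g' x -> g = g'}.
Proof.
move=> g g' Gg Gg' eqx; apply/permP=> y.
have [d Dd ->] := atransP2 (map_connected M) (in_setT x) (in_setT y).
have comm := centsP map_aut_cent.
by rewrite /= /aperm -!permM -!(comm _ _ d) // !permM eqx.
Qed.

Lemma vertex_ofP x y : reflect (exists i, y = (arc_rot ^+ i) x) (y \in vertex_of x).
Proof. exact: porbitP. Qed.

Lemma mem_vertex_of x y : (y \in vertex_of x) = (vertex_of y == vertex_of x).
Proof. by rewrite -eq_porbit_mem. Qed.

Lemma vertex_of_rot x : vertex_of (arc_rot x) = vertex_of x.
Proof. exact: (porbit_perm _ 1). Qed.

Lemma vertex_in x : vertex_of x \in vertices M.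
Proof. exact: imset_f. Qed.

Lemma map_aut_rotX g x i :
  g \in map_aut M -> g ((arc_rot ^+ i) x) = (arc_rot ^+ i) (g x).
Proof.
move=> Gg; elim: i => [|i IH]; first by rewrite !perm1.
by rewrite !expgSr !permM map_aut_rot // IH.
Qed.

Lemma vertex_act g x :
  g \in map_aut M -> ('P^*)%act (vertex_of x) g = vertex_of (g x).
Proof.
move=> Gg; apply/setP=> y; apply/imsetP/idP=> [[_ /vertex_ofP[i ->] ->] | ].
  by rewrite /= /aperm map_aut_rotX //; apply/vertex_ofP; exists i.
case/vertex_ofP=> i ->; exists ((arc_rot ^+ i) x).
  by apply/vertex_ofP; exists i.
by rewrite /= /aperm map_aut_rotX.
Qed.

Lemma mem_vertex_stab g x :
  (g \in 'C_(map_aut M)[vertex_of x | 'P^*])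
    = (g \in map_aut M) && (vertex_of (g x) == vertex_of x).
Proof.
rewrite in_setI; case Gg: (g \in map_aut M) => //=.
by apply/astab1P/eqP; rewrite vertex_act.
Qed.

Hypothesis regM : orientably_regular M.

Lemma map_aut_move x y : exists2 g, g \in map_aut M & g x = y.
Proof.
by have [g Gg ->] := atransP2 regM (in_setT x) (in_setT y); exists g.
Qed.

Lemma map_aut_vertex_trans : [transitive map_aut M, on vertices M | 'P^*].
Proof.
have [x0 _ _] := imsetP regM.
apply/imsetP; exists (vertex_of x0); first exact: vertex_in.
apply/setP=> V; apply/imsetP/imsetP=> [[x _ ->] | [g Gg ->]].
  by have [g Gg <-] := map_aut_move x0 x; exists g => //=; rewrite vertex_act.
by exists (g x0); rewrite //= vertex_act.
Qed.

(** [h] need not agree with [arc_rot] away from [x]; the induction uses that the two permutations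
    commute. *)
Lemma map_aut_expX h x i : h \in map_aut M -> h x = arc_rot x ->
  (h ^+ i) x = (arc_rot ^+ i) x.
Proof.
move=> Gh hx; elim: i => [|i IH]; first by rewrite !perm1.
by rewrite expgS permM hx map_aut_rot ?groupX // IH expgSr permM.
Qed.

(** An automorphism fixing the vertex sends [x] to a rotated arc, so it agrees at [x] with a power
    of [h], and hence everywhere. *)
Lemma vertex_stab_cycle h x : h \in map_aut M -> h x = arc_rot x ->
  'C_(map_aut M)[vertex_of x | 'P^*] = <[h]>.
Proof.
move=> Gh hx; apply/setP=> g; rewrite mem_vertex_stab.
apply/andP/cycleP=> [[Gg] | [i ->]].
  rewrite -mem_vertex_of => /vertex_ofP[i gx]; exists i.
  by apply: (map_aut_inj (x := x)); rewrite ?groupX // map_aut_expX.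
rewrite groupX // map_aut_expX // -mem_vertex_of; split=> //.
by apply/vertex_ofP; exists i.
Qed.

(** If [x] is a loop then, by regularity, so is every arc; connectedness then leaves a single
    vertex. *)
Lemma rev_same_vertex_stab x : arc_rev x \in vertex_of x ->
  'C_(map_aut M)[vertex_of x | 'P^*] = map_aut M.
Proof.
move=> Vrx; set D := <<[set @arc_rot M; @arc_rev M]>>.
have actV : D \subset 'N(vertex_of x | 'P).
  rewrite gen_subG; apply/subsetP=> d; rewrite !inE => /orP[]/eqP-> /=;
    apply/subsetP=> y; rewrite inE /= /aperm !mem_vertex_of ?vertex_of_rot //.
  have [g Gg gx] := map_aut_move x y; rewrite -gx => /eqP gxx.
  rewrite -map_aut_rev // -vertex_act //.
  move: Vrx; rewrite mem_vertex_of => /eqP->.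
  by rewrite vertex_act ?gxx.
have VT y : vertex_of y = vertex_of x.
  have [d Dd ->] := atransP2 (map_connected M) (in_setT x) (in_setT y).
  apply/eqP; rewrite -mem_vertex_of (astabs_act _ (subsetP actV d Dd)).
  by rewrite mem_vertex_of.
by apply/setP=> g; rewrite mem_vertex_stab VT eqxx andbT.
Qed.

(** A normal subgroup fixing one vertex fixes all of them, by transitivity on vertices. *)
Lemma corefree_vertex_stab (N : {group {perm M}}) (V : {set M}) :
    [faithful map_aut M, on vertices M | 'P^*] -> V \in vertices M ->
    N <| map_aut M -> N \subset 'C_(map_aut M)[V | 'P^*] -> N :=: 1.
Proof.
move=> faithM VM /andP[sNG nNG] sNS; apply/trivgP.
apply: subset_trans faithM; rewrite subsetI sNG.
apply/subsetP=> a Na; apply/astabP=> W WM.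
have [g Gg ->] := atransP2 map_aut_vertex_trans VM WM.
rewrite actCJV; congr (('P^*)%act _ g); apply/astab1P.
suff : a ^ g^-1 \in N by move/(subsetP sNS)/setIP=> [].
by rewrite memJ_norm ?groupV // (subsetP nNG).
Qed.

(** Otherwise the whole group would be a normal subgroup of a stabiliser, hence trivial; but some
    automorphism reverses [x]. *)
Lemma vertex_stab_neq x : [faithful map_aut M, on vertices M | 'P^*] ->
  'C_(map_aut M)[vertex_of x | 'P^*] != map_aut M.
Proof.
move=> faithM; apply/eqP=> CG.
have G1 : map_aut M :=: 1.
  by apply: corefree_vertex_stab (vertex_in x) _ _; rewrite ?CG.
have [l Gl lx] := map_aut_move x (arc_rev x).
move: Gl lx; rewrite G1 => /set1P->; rewrite perm1 => /esym/eqP.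
by rewrite (negPf (arc_rev_fixfree x)).
Qed.

End MapAut.

(** This supplies the spanning hypothesis of [cyclic_span_admissible]: [phi @: W] is a nontrivial
    subgroup of [K] normalised by [h]. *)
Lemma minnormal_field_span (gT : finGroupType) (K : {group gT}) (h : gT)
    (F : finFieldType) (s : {unit F}) (phi : F -> gT) (W : {group F}) :
    minnormal K <[h]> -> injective phi -> phi @: [set: F] = K ->
    {morph phi : x y / (x + y)%R >-> x * y} ->
    (forall x, phi (val s * x)%R = phi x ^ h) ->
    1%R \in W -> (forall x, x \in W -> (val s * x)%R \in W) ->
  W = [set: F] :> {set F}.
Proof.
move=> minK phi_inj phiK phiD phih W1 Ws.
have [_ minKh] := mingroupP minK.
have phi0 : phi 0%R = 1.
  by apply: (mulgI (phi 0%R)); rewrite -phiD addr0 mulg1.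
have gP : group_set (phi @: W).
  apply/group_setP; split; first by rewrite -phi0 imset_f ?group1.
  move=> _ _ /imsetP[x Wx ->] /imsetP[y Wy ->].
  by rewrite -phiD imset_f // (groupM Wx Wy).
apply: (imset_inj phi_inj); rewrite phiK; apply: (minKh (Group gP)).
  apply/andP; split.
    apply/trivgPn; exists (phi 1%R); first exact: imset_f.
    by rewrite -phi0 (inj_eq phi_inj) oner_eq0.
  rewrite cycle_subG inE; apply/subsetP=> _ /imsetP[_ /imsetP[x Wx ->] ->] /=.
  by rewrite -phih imset_f ?Ws.
by rewrite /= -phiK imsetS ?subsetT.
Qed.

(** * Field coordinates on the arcs of an affine map *)

Section AffineMap.

Variables (M : oriented_map) (regM : orientably_regular M).
Variables (x0 : M) (h l : {perm M}).
Local Notation G := (map_aut M).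
Hypotheses (Gh : h \in G) (hx0 : h x0 = arc_rot x0).
Hypothesis lx0 : l x0 = arc_rev x0.

Variables (K : {group {perm M}}) (a0 k0 : {perm M}).
Hypotheses (defG : K ><| <[h]> = G) (cKh : 'C_<[h]>(K) = 1).
Hypotheses (Ha0 : a0 \in <[h]>) (lE : l = a0 * k0).

Variables (F : finFieldType) (s : {unit F}) (phi : F -> {perm M}).
Hypotheses (phi_inj : injective phi) (phiK : phi @: [set: F] = K).
Hypothesis phiD : {morph phi : x y / (x + y)%R >-> x * y}.
Hypothesis phi1 : phi 1%R = k0.
Hypothesis phih : forall x, phi (val s * x)%R = phi x ^ h.

Lemma affine_phi_aut t : phi t \in G.
Proof.
have [/andP[sKG _] _ _ _ _] := sdprod_context defG.
by rewrite (subsetP sKG) // -phiK imset_f.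
Qed.

Lemma affine_phiX i x : phi (val s ^+ i * x)%R = phi x ^ (h ^+ i).
Proof.
elim: i => [|i IH]; first by rewrite expr0 mul1r expg0 conjg1.
by rewrite exprS -mulrA phih IH expgSr conjgM.
Qed.

(** Conjugation by [h ^+ i] on [K] is multiplication by [val s ^+ i] on [F], and [<[h]>] acts
    faithfully on [K] by [cKh]. *)
Lemma affine_expE i j : (val s ^+ i == val s ^+ j)%R = (h ^+ i == h ^+ j).
Proof.
apply/eqP/eqP=> [sij | hij]; last first.
  apply: phi_inj; rewrite -[X in phi X]mulr1 -[X in _ = phi X]mulr1.
  by rewrite !affine_phiX hij.
apply/eqP; rewrite eq_mulgV1 -in_set1 -[[set 1]]cKh inE.
rewrite groupM ?groupV ?mem_cycle //; apply/centP=> k.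
rewrite -phiK => /imsetP[x _ ->]; apply/esym/commgP/conjg_fixP.
by rewrite conjgM -affine_phiX sij affine_phiX conjgK.
Qed.

Lemma affine_order : #[s] = #[h].
Proof.
have expE i : (s ^+ i == 1) = (h ^+ i == 1).
  by rewrite -(affine_expE i 0) -val_eqE /= FinRing.val_unitX.
apply/eqP; rewrite eqn_dvd !order_dvdn; apply/andP.
by split; [rewrite expE | rewrite -expE]; rewrite expg_order.
Qed.

Lemma affine_decomp x : exists i t, x = (h ^+ i * phi t) x0.
Proof.
have [g Gg <-] := map_aut_move regM x0 x.
have [_ KH nKH _] := sdprodP defG.
have : g \in <[h]> * K by rewrite (normC nKH) KH.
case/mulsgP=> _ k /cycleP[i ->] Kk ->; exists i.
by move: Kk; rewrite -phiK => /imsetP[t _ ->]; exists t.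
Qed.

Lemma affine_vertex a t : a \in <[h]> ->
  vertex_of ((a * phi t) x0) = vertex_of (phi t x0).
Proof.
rewrite -(vertex_stab_cycle Gh hx0) mem_vertex_stab => /andP[Ga /eqP ax].
by rewrite permM -vertex_act ?affine_phi_aut // ax vertex_act ?affine_phi_aut.
Qed.

Lemma affine_vertex_inj : injective (fun t => vertex_of (phi t x0)).
Proof.
move=> t u /= tu; have [_ _ _ tiKH] := sdprodP defG.
apply: phi_inj; apply/eqP; rewrite eq_mulgV1 -in_set1 -[[set 1]]tiKH inE.
rewrite -(vertex_stab_cycle Gh hx0) mem_vertex_stab.
rewrite !groupM ?groupV ?affine_phi_aut ?(=^~ phiK, imset_f) //=.
rewrite permM -vertex_act ?groupV ?affine_phi_aut // tu.
by rewrite vertex_act ?groupV ?affine_phi_aut // permK.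
Qed.

(** The coordinate of the initial vertex: the [t] whose translation [phi t] carries the base vertex
    there. Such a [t] always exists, so the default is never reached. *)
Definition affine_src (x : M) : F :=
  odflt 0%R [pick t | vertex_of x == vertex_of (phi t x0)].

Lemma affine_srcE a t : a \in <[h]> -> affine_src ((a * phi t) x0) = t.
Proof.
move=> Ha; rewrite /affine_src; case: pickP => [u | /(_ t)] /=.
  by rewrite affine_vertex // => /eqP/affine_vertex_inj.
by rewrite affine_vertex ?eqxx.
Qed.

(** Moving [k0 = phi 1] past [h ^+ i] turns [l * h ^+ i * phi t] into
    [a0 * h ^+ i * phi (val s ^+ i + t)], whose first two factors fix the base vertex. *)
Lemma affine_src_rev i t :
  affine_src (arc_rev ((h ^+ i * phi t) x0)) = (t + val s ^+ i)%R.
Proof.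
have Gi : h ^+ i * phi t \in G by rewrite groupM ?groupX ?affine_phi_aut.
rewrite -map_aut_rev // -lx0 -permM lE -mulgA [k0 * _]mulgA [k0 * _]conjgC.
rewrite -[_ * _ * phi t]mulgA mulgA -phi1 -affine_phiX mulr1 -phiD addrC.
by rewrite affine_srcE // groupM ?mem_cycle.
Qed.

Lemma affine_rotE i t :
  arc_rot ((h ^+ i * phi t) x0) = (h ^+ i.+1 * phi t) x0.
Proof.
rewrite -map_aut_rot; last by rewrite groupM ?groupX ?affine_phi_aut.
by rewrite -hx0 -permM mulgA -expgS.
Qed.

Lemma affine_map_paley (adm : admissible #|F| #[s]) :
  map_isomorphic M
    (paley_map adm (erefl #|F|) (erefl #[s] : #|<[s]>%G| = #[s])
       (generator_cycle s)).
Proof.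
pose S := <[s]>%G.
have adj x : paley_adj S (affine_src x) (affine_src (arc_rev x)).
  have [i [t ->]] := affine_decomp x.
  rewrite affine_src_rev affine_srcE ?mem_cycle //.
  apply: (paley_adj_sym adm (erefl _) (erefl _)).
  rewrite /paley_adj addrAC subrr add0r; apply/imsetP; exists (s ^+ i).
    exact: mem_cycle.
  by rewrite FinRing.val_unitX.
(* In these coordinates [(h ^+ i * phi t) x0] runs from [t] to [t + val s ^+ i], and every arc has
   this form. *)
pose f (x : M) : paley_arc S :=
  exist _ (affine_src x, affine_src (arc_rev x)) (adj x).
have f_inj : injective f.
  move=> x y /(congr1 val) [].
  have [i [t ->]] := affine_decomp x; have [j [u ->]] := affine_decomp y.
  rewrite !affine_src_rev !affine_srcE ?mem_cycle // => -> /addrI/eqP.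
  by rewrite affine_expE => /eqP->.
have f_onto y : exists x, f x == y.
  case: y => [[v w] vw].
  have /imsetP[_ /cycleP[i ->] /= wv] := paley_adj_sym adm (erefl _) (erefl _) vw.
  exists ((h ^+ i * phi v) x0); rewrite -val_eqE /=.
  rewrite affine_src_rev affine_srcE ?mem_cycle //.
  by rewrite -FinRing.val_unitX /= -wv addrC subrK.
exists f; split.
- exists (fun y => xchoose (f_onto y)) => [x|y]; last exact/eqP/(xchooseP (f_onto y)).
  by apply: f_inj; apply/eqP/(xchooseP (f_onto (f x))).
- move=> x; apply: val_inj; rewrite permE /=.
  have [i [t ->]] := affine_decomp x.
  rewrite affine_rotE !affine_src_rev !affine_srcE ?mem_cycle //.
  by rewrite addrAC subrr add0r exprS.
- by move=> x; apply: val_inj; rewrite permE /= arc_rev_involutive.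
Qed.

End AffineMap.

(** * From a primitive faithful action to a Paley map *)

Lemma primitive_faithful_paley (M : oriented_map) :
    orientably_regular M -> [primitive map_aut M, on vertices M | 'P^*] ->
    [faithful map_aut M, on vertices M | 'P^*] ->
  exists (F : finFieldType) (s : {unit F}) (adm : admissible #|F| #[s]),
    map_isomorphic M
      (paley_map adm (erefl #|F|) (erefl #[s] : #|<[s]>%G| = #[s])
         (generator_cycle s)).
Proof.
move=> regM primM faithM; set G := map_aut M.
have [x0 _ _] := imsetP regM.
have [h Gh hx0] := map_aut_move regM x0 (arc_rot x0).
have [l Gl lx0] := map_aut_move regM x0 (arc_rev x0).
have stabE := vertex_stab_cycle Gh hx0.
have neqH := vertex_stab_neq regM x0 faithM.
have maxH : maximal <[h]> G.
  have /orP[|//] : maximal_eq <[h]> G; last by rewrite -stabE (negPf neqH).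
  by rewrite -stabE -(trans_prim_astab (vertex_in x0)) ?map_aut_vertex_trans.
have coreH (N : {group {perm M}}) : N <| G -> N \subset <[h]> -> N :=: 1.
  by rewrite -stabE; apply: corefree_vertex_stab (vertex_in x0).
have [p [K [pr_p abelK defG minK cKh]]] :=
  corefree_maximal_abelian_affine maxH (cycle_abelian h) coreH.
have [_ KH nKH _] := sdprodP defG.
have /mulsgP[a0 k0 Ha0 Kk0 lE] : l \in <[h]> * K by rewrite (normC nKH) KH.
(* If [k0 = 1], then [l] fixes the base vertex, so [x0] is a loop and the vertex stabiliser is all
   of [G]. *)
have ntk0 : k0 != 1.
  apply: contraNneq neqH => k01; apply/eqP/(rev_same_vertex_stab regM).
  rewrite mem_vertex_of -lx0; have : l \in <[h]> by rewrite lE k01 mulg1.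
  by rewrite -stabE mem_vertex_stab => /andP[].
have [F [s [phi [phi_inj phiK phiD phi1 phih]]]] :=
  minnormal_abelem_field abelK minK Kk0 ntk0.
have cardF : #|F| = #|K| by rewrite -phiK card_imset ?cardsT.
have [e cardK] := p_natP (abelem_pgroup abelK).
have adm : admissible #|F| #[s].
  apply: cyclic_span_admissible (pr_p) _ _ _.
  - by rewrite cardF cardK.
  - move=> p_gt2; rewrite (affine_order cKh phi_inj phiK phih).
    (* [l] is an involution, since [l ^+ 2] fixes [x0]. For odd [p] the order of [K] is odd, so the
       factor 2 of [#|G|] must divide [#[h] = #[s]]. *)
    have : (2 %| #|G|)%N.
      suff <- : #[l] = 2%N by apply: order_dvdG.
      apply: nt_prime_order => //.
        apply: (map_aut_inj (x := x0)); rewrite ?groupX ?group1 //.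
        by rewrite permM lx0 map_aut_rev // lx0 arc_rev_involutive perm1.
      apply/eqP=> l1; move: (arc_rev_fixfree x0).
      by rewrite -lx0 l1 perm1 eqxx.
    rewrite -(sdprod_card defG) dvdn2 oddM cardK oddX.
    by case: (even_prime pr_p) p_gt2 => [-> | ->]; rewrite ?orbT.
  - move=> W; exact: minnormal_field_span minK phi_inj phiK phiD phih.
exists F, s, adm.
exact: (affine_map_paley regM Gh hx0 lx0 defG cKh Ha0 lE phi_inj phiK phiD phi1).
Qed.

(** * Primitivity and faithfulness for Paley maps *)

Section PaleyPrimitive.

Context (q n : nat) (adm : admissible q n) (F : finFieldType) (cardF : #|F| = q).
Context (S : {group {unit F}}) (cardS : #|S| = n).
Context (s : {unit F}) (genS : generator S s).
Local Notation N := (paley_map adm cardF cardS genS).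
Variables (M : oriented_map) (regM : orientably_regular M).
Variables (f : M -> N) (f' : N -> M).
Hypotheses (fK : cancel f f') (f'K : cancel f' f).
Hypothesis fR : {morph f : x / arc_rot x >-> arc_rot x}.
Hypothesis fL : {morph f : x / arc_rev x >-> arc_rev x}.
Local Notation G := (map_aut M).
Implicit Types (x y : M) (g : {perm M}).

Definition paley_src x : F := (val (f x : paley_arc S)).1.

Lemma paley_srcE x : val (f x : paley_arc S) = (paley_src x, paley_src (arc_rev x)).
Proof. by rewrite /paley_src fL permE /=; case: (val (f x)). Qed.

Lemma paley_src_inj x y : paley_src x = paley_src y ->
  paley_src (arc_rev x) = paley_src (arc_rev y) -> x = y.
Proof.
move=> exy erxy; apply: (can_inj fK); apply: (val_inj (sT := paley_arc S)).
by rewrite !paley_srcE exy erxy.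
Qed.

Lemma paley_src_rot x : paley_src (arc_rot x) = paley_src x.
Proof. by rewrite /paley_src fR permE. Qed.

Lemma paley_src_rev_rot x :
  paley_src (arc_rev (arc_rot x)) =
    (paley_src x + val s * (paley_src (arc_rev x) - paley_src x))%R.
Proof.
have /= := paley_srcE (arc_rot x); rewrite fR permE /= paley_srcE /=.
by case=> _ <-.
Qed.

Lemma paley_src_rotX x i :
  paley_src ((arc_rot ^+ i) x) = paley_src x /\
  paley_src (arc_rev ((arc_rot ^+ i) x)) =
    (paley_src x + val s ^+ i * (paley_src (arc_rev x) - paley_src x))%R.
Proof.
elim: i => [|i [IH1 IH2]].
  by rewrite perm1 expr0 mul1r addrC subrK.
rewrite expgSr permM paley_src_rot paley_src_rev_rot IH2 IH1; split=> //.
by rewrite [X in (_ * X)%R]addrAC subrr add0r mulrA -exprS.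
Qed.

Lemma paley_src_rev x : exists2 u, u \in S &
  paley_src (arc_rev x) = (paley_src x + val u)%R.
Proof.
have := paley_adj_sym adm cardF cardS (valP (f x : paley_arc S)).
rewrite paley_srcE /= => /imsetP[u Su /= eu]; exists u => //.
by rewrite -[\val u]eu addrC subrK.
Qed.

(** Since [s] generates [S], the rotation is transitive on the arcs leaving a given field
    element. *)
Lemma paley_src_vertex x y :
  (vertex_of x == vertex_of y) = (paley_src x == paley_src y).
Proof.
rewrite -mem_vertex_of; apply/idP/eqP=> [/vertex_ofP[i ->] | exy].
  by case: (paley_src_rotX y i).
have [a Sa ea] := paley_src_rev x; have [b Sb eb] := paley_src_rev y.
have : b^-1 * a \in <[s]> by rewrite -(eqP genS) groupM ?groupV.
case/cycleP=> i ei; apply/vertex_ofP; exists i.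
have [e1 e2] := paley_src_rotX y i; apply: paley_src_inj; first by rewrite e1.
rewrite e2 ea eb exy [X in (_ * X)%R]addrAC subrr add0r; congr (_ + _)%R.
by rewrite -FinRing.val_unitX -ei mulrC /= mulrA divrr ?mul1r ?(valP b).
Qed.

Lemma paley_src_onto (t : F) : exists x, paley_src x = t.
Proof.
have tP : paley_adj S t (t - 1)%R.
  by rewrite /paley_adj opprB addrC subrK; apply/imsetP; exists 1.
pose y : paley_arc S := exist _ (t, t - 1)%R tP.
by exists (f' y); rewrite /paley_src f'K.
Qed.

(** Affine maps with linear part in [S] keep differences in [S], and their linear part commutes with
    multiplication by [s]. *)
Lemma paley_affine (u : {unit F}) (b : F) : u \in S ->
  exists2 g, g \in G & forall x, paley_src (g x) = (val u * paley_src x + b)%R.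
Proof.
move=> Su; pose a (v : F) := (val u * v + b)%R.
have aB v w : (a v - a w = val u * (v - w))%R.
  by rewrite /a opprD addrACA subrr addr0 -mulrBr.
have aP (y : paley_arc S) : paley_adj S (a (val y).1) (a (val y).2).
  rewrite /paley_adj aB; have /imsetP[c Sc ->] := valP y.
  by apply/imsetP; exists (u * c); rewrite ?groupM.
pose A (y : paley_arc S) : paley_arc S := exist _ (a (val y).1, a (val y).2) (aP y).
pose g0 x := f' (A (f x)).
have a_inj : injective a by move=> v w /addIr/(mulrI (valP u)).
have src_g x : paley_src (g0 x) = a (paley_src x).
  by rewrite /paley_src /g0 f'K.
have g0L x : g0 (arc_rev x) = arc_rev (g0 x).
  apply: (can_inj fK); rewrite fL /g0 !f'K fL.
  by apply: (val_inj (sT := paley_arc S)); rewrite !permE.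
have g0R x : g0 (arc_rot x) = arc_rot (g0 x).
  apply: (can_inj fK); rewrite fR /g0 !f'K fR.
  apply: (val_inj (sT := paley_arc S)); rewrite !permE /= aB; congr (_, _).
  by rewrite /a mulrDr addrAC mulrCA.
have g0_inj : injective g0.
  move=> x y exy; apply: paley_src_inj; apply: a_inj; rewrite -!src_g ?exy //.
  by rewrite !g0L exy.
exists (perm g0_inj); last by move=> x; rewrite permE.
by apply/map_autP; split=> x; rewrite !permE.
Qed.

Lemma paley_faithful : [faithful G, on vertices M | 'P^*].
Proof.
apply/subsetP=> g /setIP[Gg /astabP fix_g]; apply/set1P/permP=> x.
have src_g y : paley_src (g y) = paley_src y.
  apply/eqP; rewrite -paley_src_vertex -vertex_act //.
  by apply/eqP/fix_g/vertex_in.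
by rewrite perm1; apply: paley_src_inj; rewrite -?map_aut_rev.
Qed.

Lemma paley_primitive : [primitive G, on vertices M | 'P^*].
Proof.
have [x0 x00] := paley_src_onto 0%R.
rewrite (trans_prim_astab (vertex_in x0)) ?map_aut_vertex_trans //.
apply/maximal_eqP; split=> [|L sHL sLG]; first exact: subsetIl.
have GL g : g \in L -> g \in G by apply: subsetP.
have stabE g : g \in G ->
    (g \in 'C_G[vertex_of x0 | 'P^*]) = (paley_src (g x0) == 0%R).
  by move=> Gg; rewrite mem_vertex_stab Gg paley_src_vertex x00.
(* As [L] contains the stabiliser of the vertex [0], membership in [L] depends only on the image of
   [0]. *)
have memL g g' : g \in L -> g' \in G -> paley_src (g' x0) = paley_src (g x0) ->
    g' \in L.
  move=> Lg Gg' /eqP; have Gg := GL g Lg; rewrite -paley_src_vertex => /eqP gg'.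
  rewrite -(groupMr _ (groupVr Lg)) (subsetP sHL) // mem_vertex_stab.
  rewrite groupM ?groupV //= permM -vertex_act ?groupV // gg'.
  by rewrite vertex_act ?groupV // permK.
pose W := [set paley_src (g x0) | g : {perm M} in L].
have W0 : 0%R \in W by apply/imsetP; exists 1; rewrite ?group1 // perm1.
have WD b c : b \in W -> c \in W -> (b + c)%R \in W.
  move=> /imsetP[g Lg ->] /imsetP[g' Lg' ->].
  have [t Gt tE] := paley_affine (paley_src (g' x0)) (group1 S).
  apply/imsetP; exists (g * t); last by rewrite permM tE mul1r.
  by rewrite groupM // (memL g') // tE x00 mulr0 add0r.
have WM (u : {unit F}) b : u \in S -> b \in W -> (val u * b)%R \in W.
  move=> Su /imsetP[g Lg ->]; have [m Gm mE] := paley_affine 0%R Su.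
  apply/imsetP; exists (g * m); last by rewrite permM mE addr0.
  by rewrite groupM // (subsetP sHL) // stabE // mE x00 mulr0 addr0.
(* The multipliers [d] preserving [W], the orbit of [0] under [L], form a subring containing [S],
   hence all of [F]. *)
have gD : group_set [set d : F | [forall w in W, (d * w)%R \in W]].
  apply/group_setP; split=> [|b c]; rewrite !inE.
    by apply/forall_inP=> w _; rewrite mul0r.
  move=> /forall_inP Wb /forall_inP Wc; apply/forall_inP=> w Ww.
  by rewrite mulrDl WD ?Wb ?Wc.
have DT : Group gD = [set: F] :> {set F}.
  apply: (paley_span adm cardF cardS).
    apply/subsetP=> _ /imsetP[u Su ->]; rewrite inE.
    by apply/forall_inP=> w Ww; apply: (WM u w).
  move=> b c; rewrite !inE => /forall_inP Wb /forall_inP Wc.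
  by apply/forall_inP=> w Ww; rewrite -mulrA Wb ?Wc.
have [W1 | /subsetPn[w Ww]] := boolP (W \subset [set 0%R]); [left |].
  apply/eqP; rewrite eqEsubset sHL andbT; apply/subsetP=> g Lg.
  by rewrite stabE ?GL // -in_set1 (subsetP W1) //; apply/imsetP; exists g.
rewrite inE => nzw; right.
apply/eqP; rewrite eqEsubset sLG; apply/subsetP=> g Gg.
(* With every scalar preserving [W], a nonzero [w] in [W] yields any prescribed image of [0], so [L]
   is all of [G]. *)
have : (paley_src (g x0) / w)%R \in Group gD by rewrite DT inE.
rewrite inE => /forall_inP/(_ w Ww); rewrite divfK // => /imsetP[g' Lg' eg].
exact: memL Lg' Gg eg.
Qed.

End PaleyPrimitive.

Theorem theorem5p1 (M : oriented_map) (regM : orientably_regular M) :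
  [primitive map_aut M, on vertices M | 'P^*] /\
  [faithful map_aut M, on vertices M | 'P^*] <->
  exists (q n : nat) (adm : admissible q n)
         (F : finFieldType) (cardF : #|F| = q)
         (S : {group {unit F}}) (cardS : #|S| = n)
         (s : {unit F}) (genS : generator S s),
    map_isomorphic M (paley_map adm cardF cardS genS).
Proof.
split=> [[primM faithM] | ].
  have [F [s [adm isoM]]] := primitive_faithful_paley regM primM faithM.
  by exists #|F|, #[s], adm, F, (erefl _), <[s]>%G, (erefl _), s,
    (generator_cycle s).
case=> q [n [adm [F [cardF [S [cardS [s [genS [f [[f' fK f'K] fR fL]]]]]]]]]].
split; first exact: (paley_primitive regM fK f'K fR fL).
exact: (paley_faithful fK fR fL).
Qed.
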